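(* Let $P(q,z,t)=\sum_{\pi} z^{|\pi|}q^{|123(\pi)|}t^{|12(\pi)|}$, the sum over all $(132)$-avoiding permutations $\pi$ (including the empty one). Let $B(q,z,t)=\sum_{m\ge 0}\phi_m(q,t)z^m$ be the denominator of $P$, i.e. the formal series with $\phi_0=1$ satisfying \[B(q,z,t)=B(q,zt,tq)-z\,B(q,t^2qz,tq^2),\] so that $P(q,z,t)=B(q,zt,tq)/B(q,z,t)$. Then \[ B(q,z,t)=1+\sum_{m=1}^{\infty}\left(-zq^3t^{-2}\right)^m\sum_{j_1,\dots,j_m\ge 2} t^{\sum_{r=1}^m r j_r}\, q^{\frac12\left\{\sum_{r,s=1}^m \min(r,s)\, j_r j_s \;-\;5\sum_{r=1}^m r j_r\right\}}. \]
   Context: For a permutation $\pi$ of $\{1,\dots,n\}$: $|\pi|=n$; $|12(\pi)|$ is the number of pairs $i<j$ with $\pi(i)<\pi(j)$; $|123(\pi)|$ is the number of triples $i<j<k$ with $\pi(i)<\pi(j)<\pi(k)$; $\pi$ is $(132)$-avoiding if there is no triple $i<j<k$ with $\pi(i)<\pi(k)<\pi(j)$. The series $P$ satisfies $P(q,z,t)=1/(1-zP(q,zt,tq))$, and writing $P=A/B$ one has $A(q,z,t)=B(q,zt,tq)$; equivalently the coefficients satisfy $\phi_0=1$ and $\phi_m(q,t)=t^m\phi_m(q,qt)-t^{2m-2}q^{m-1}\phi_{m-1}(q,tq^2)$ for $m\ge1$, with each $\phi_m$ a formal power series in $t$. *)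

(* Defs.v *)
From HB Require Import structures.
From mathcomp Require Import all_boot all_order all_algebra perm.
From mathcomp Require Import boolp classical_sets functions cardinality fsbigop.
Set Implicit Arguments.
Unset Strict Implicit.
Unset Printing Implicit Defensive.
Import GRing.Theory.
Local Open Scope ring_scope.

(* {fps R}: formal power series in one variable over R, given by their
   coefficients; f n is the coefficient of degree n, * is the Cauchy product.
   Series in z and t are {fps {fps K}}: power series in z whose coefficients
   are power series in t. *)
Record fps (R : Type) := Fps { fps_coef :> nat -> R }.
Notation "{ 'fps' R }" := (fps R) (at level 0, format "{ 'fps'  R }") : type_scope.

Section FpsRing.
Variable R : comNzRingType.
Implicit Types f g h : {fps R}.

HB.instance Definition _ := gen_eqMixin {fps R}.
HB.instance Definition _ := gen_choiceMixin {fps R}.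

Lemma fpsP f g : (forall n, f n = g n) -> f = g.
Proof. by case: f g => [f] [g] /= fg; congr Fps; apply: funext. Qed.

Definition fps_const (c : R) : {fps R} := Fps (fun n => if n == 0%N then c else 0).
Definition fps_X : {fps R} := Fps (fun n => if n == 1%N then 1 else 0).

Definition fps_opp f : {fps R} := Fps (fun n => - f n).
Definition fps_add f g : {fps R} := Fps (fun n => f n + g n).
Definition fps_mul f g : {fps R} :=
  Fps (fun n => \sum_(i < n.+1) f i * g (n - i)%N).

Fact fps_addA : associative fps_add.
Proof. by move=> f g h; apply: fpsP => n /=; rewrite addrA. Qed.
Fact fps_addC : commutative fps_add.
Proof. by move=> f g; apply: fpsP => n /=; rewrite addrC. Qed.
Fact fps_add0 : left_id (fps_const 0) fps_add.
Proof. by move=> f; apply: fpsP => n /=; case: ifP; rewrite add0r. Qed.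
Fact fps_addN : left_inverse (fps_const 0) fps_opp fps_add.
Proof. by move=> f; apply: fpsP => n /=; rewrite addNr; case: ifP. Qed.
HB.instance Definition _ :=
  GRing.isZmodule.Build {fps R} fps_addA fps_addC fps_add0 fps_addN.

Let trunc N f : {poly R} := \poly_(i < N) f i.

Fact fps_mul_trunc N f g n : (n < N)%N ->
  (fps_mul f g) n = (trunc N f * trunc N g)`_n.
Proof.
move=> nN; rewrite coefM; apply: eq_bigr => i _; rewrite !coef_poly.
by rewrite (leq_ltn_trans _ nN) ?(leq_ltn_trans _ nN) ?leq_subr // -ltnS.
Qed.

Fact fps_mulA : associative fps_mul.
Proof.
move=> f g h; apply: fpsP => n.
rewrite !(fps_mul_trunc _ _ (ltnSn n)).
have E u v : exists w : {poly R}, trunc n.+1 (fps_mul u v)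
    = trunc n.+1 u * trunc n.+1 v - w * 'X^(n.+1).
  exists (drop_poly n.+1 (trunc n.+1 u * trunc n.+1 v)).
  set p := trunc n.+1 u * trunc n.+1 v.
  rewrite -[X in X - _](poly_take_drop n.+1) addrK.
  apply/polyP => i; rewrite coef_poly coef_take_poly.
  by case: ifP => // ilt; rewrite (fps_mul_trunc _ _ ilt).
have [w ->] := E g h; have [w' ->] := E f g.
rewrite mulrBr mulrBl mulrA !coefB; congr (_ - _).
by rewrite mulrA [_ * _ * trunc _ _]mulrAC !coefMXn ltnSn.
Qed.

Fact fps_mulC : commutative fps_mul.
Proof.
by move=> f g; apply: fpsP => n; rewrite !(fps_mul_trunc _ _ (ltnSn n)) mulrC.
Qed.

Fact fps_mul1 : left_id (fps_const 1) fps_mul.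
Proof.
move=> f; apply: fpsP => n /=; rewrite big_ord_recl /= mul1r subn0.
by rewrite big1 ?addr0 // => i _; rewrite mul0r.
Qed.

Fact fps_mulDl : left_distributive fps_mul fps_add.
Proof.
move=> f g h; apply: fpsP => n /=; rewrite -big_split /=.
by apply: eq_bigr => i _; rewrite mulrDl.
Qed.

Fact fps_one_neq0 : fps_const 1 != fps_const 0.
Proof. by apply/eqP => /(congr1 (fun f : {fps R} => f 0%N)) /eqP; rewrite oner_eq0. Qed.

HB.instance Definition _ := GRing.Zmodule_isComNzRing.Build {fps R}
  fps_mulA fps_mulC fps_mul1 fps_mulDl fps_one_neq0.

(* fps_dilate c f is the series f(cX). *)
Definition fps_dilate (c : R) f : {fps R} := Fps (fun n => c ^+ n * f n).

End FpsRing.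

Definition fps_map (R S : Type) (h : R -> S) (f : {fps R}) : {fps S} :=
  Fps (fun n => h (f n)).

(* The variable q is the generator of the field of rational functions Q(q). *)
Definition Qq : fieldType := {fraction {poly rat}}.
Definition q : Qq := FracField.tofrac ('X : {poly rat}).
Definition qc (c : Qq) : {fps Qq} := fps_const c.
Definition t : {fps Qq} := fps_X Qq.
Definition z : {fps {fps Qq}} := fps_X {fps Qq}.

(* subst_zt u c B is B(q, z u, t c), for u a series in t and c in Q(q): the
   coefficient of z^m is phi_m(q, t c) u^m. *)
Definition subst_zt (u : {fps Qq}) (c : Qq) (B : {fps {fps Qq}}) :
    {fps {fps Qq}} :=
  fps_dilate u (fps_map (fps_dilate c) B).

Definition avoids132 n (s : 'S_n) : bool :=
  ~~ [exists i : 'I_n, exists j : 'I_n, exists k : 'I_n,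
       [&& (i < j)%N, (j < k)%N, (s i < s k)%N & (s k < s j)%N]].

Definition num12 n (s : 'S_n) : nat :=
  #|[set p : 'I_n * 'I_n | (p.1 < p.2)%N && (s p.1 < s p.2)%N]|.

Definition num123 n (s : 'S_n) : nat :=
  #|[set p : 'I_n * 'I_n * 'I_n |
      [&& (p.1.1 < p.1.2)%N, (p.1.2 < p.2)%N,
          (s p.1.1 < s p.1.2)%N & (s p.1.2 < s p.2)%N]]|.

Definition P : {fps {fps Qq}} :=
  Fps (fun n => \sum_(s : 'S_n | avoids132 s) qc (q ^+ num123 s) * t ^+ num12 s).

(* A formal series in z^m t^k, with m : nat and k : int, as the family of its
   coefficients; no condition is imposed on the support. *)
Definition coef_family := nat -> int -> Qq.

Definition coef_zt (B : {fps {fps Qq}}) : coef_family :=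
  fun m k => if k is Posz n then B m n else 0.

Definition monomial_zt (c : Qq) (m : nat) (k : int) : coef_family :=
  fun m' k' => if (m' == m) && (k' == k) then c else 0.

(* S is the sum of the F i for i in A: each coefficient is nonzero for only
   finitely many i in A, and the coefficients add up to that of S. (Without the
   finiteness, \sum_(i \in A) would default to 0.) *)
Definition formal_sum (I : choiceType) (A : set I) (F : I -> coef_family)
    (S : coef_family) : Prop :=
  forall m k,
    finite_set [set i | A i /\ F i m k <> 0]%classic /\
    S m k = \sum_(i \in A) F i m k.

(* Pairs (m, (j_1, ..., j_m)); j_r is j at the ordinal r - 1. *)
Definition term_index := {m : nat & {ffun 'I_m -> nat}}.

Definition weight m (j : {ffun 'I_m -> nat}) : nat := (\sum_(r < m) r.+1 * j r)%N.

Definition min_form m (j : {ffun 'I_m -> nat}) : nat :=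
  (\sum_(r < m) \sum_(s < m) minn r.+1 s.+1 * j r * j s)%N.

Definition half_exponent m (j : {ffun 'I_m -> nat}) : int :=
  ((Posz (min_form j) - 5%:Z * Posz (weight j)) %/ 2)%Z.

(* The division by 2 in half_exponent is exact. *)
Lemma half_exponentE m (j : {ffun 'I_m -> nat}) :
  2%:Z * half_exponent j = Posz (min_form j) - 5%:Z * Posz (weight j).
Proof.
rewrite mulrC divzK //.
suff par : odd (min_form j) = odd (weight j).
  have -> : Posz (min_form j) - 5%:Z * Posz (weight j)
          = Posz (min_form j + weight j) - 2%:Z * Posz (3 * weight j).
    rewrite PoszD [Posz (3 * _)]PoszM mulrA -[5%:Z]/(6%:Z - 1) mulrBl mul1r.
    by rewrite opprB addrA.
  by rewrite rpredB ?dvdz_mulr // dvdzE /= dvdn2 oddD par addbb.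
rewrite /min_form /weight; elim: m j => [|m IH] j; first by rewrite !big_ord0.
pose j' := [ffun r : 'I_m => j (widen_ord (leqnSn m) r)].
have := IH j'.
rewrite !big_ord_recr /= => IHj.
under eq_bigr => r _ do rewrite big_ord_recr /=.
rewrite big_split /= !oddD.
have -> : (\sum_(i < m) minn i.+1 m.+1 * j (widen_ord (leqnSn m) i) * j ord_max
        = \sum_(i < m) minn m.+1 i.+1 * j ord_max * j (widen_ord (leqnSn m) i))%N.
  by apply: eq_bigr => i _; rewrite minnC mulnAC.
rewrite addbA -[X in X (+) odd (_ * _ * _)]addbA addbb addbF minnn; congr (_ (+) _).
  transitivity (odd (\sum_(r < m) \sum_(s < m) minn r.+1 s.+1 * j' r * j' s)).
    by congr odd; apply: eq_bigr => r _; apply: eq_bigr => s _; rewrite !ffunE.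
  by rewrite IHj; congr odd; apply: eq_bigr => r _; rewrite ffunE.
by rewrite !oddM /=; case: (odd m); case: (odd (j ord_max)).
Qed.

(* (-z q^3 t^-2)^m t^(weight j) q^(half_exponent j) *)
Definition denominator_term (x : term_index) : coef_family :=
  let m := tag x in let j := tagged x in
  monomial_zt ((- q ^+ 3) ^+ m * q ^ half_exponent j)
    m (Posz (weight j) - Posz (2 * m)).

Definition is_denominator (B : {fps {fps Qq}}) : Prop :=
  B 0%N = 1 /\
  B = subst_zt t q B - z * subst_zt (t ^+ 2 * qc q) (q ^+ 2) B.

(* Main.v *)
Require Import Defs.
From HB Require Import structures.
From mathcomp Require Import all_boot all_order all_algebra perm.
From mathcomp Require Import boolp classical_sets functions cardinality fsbigop.
From mathcomp Require Import zify ring.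
Set Implicit Arguments.
Unset Strict Implicit.
Unset Printing Implicit Defensive.
Import GRing.Theory.
Local Open Scope classical_set_scope.
Local Open Scope ring_scope.

(** Let S F = F(q, zt, tq). Splitting a 132-avoiding permutation at its maximum n
    as u n v, every letter of u exceeds every letter of v, so u and v are
    arbitrary shorter 132-avoiding permutations and n contributes |u| to 12 and
    |12(u)| to 123. Hence P = 1 + z (S P) P. For a denominator B the difference
    D = P B - S B then satisfies D = z P (S D), which forces D = 0
    coefficientwise in z.

    The functional equation of B determines its coefficients recursively, so it
    suffices to check it on the explicit series. Its z^m t^n term is a sum over
    exponents (j_1, ..., j_m) of weight n + 2m; the tuples with j_m = 2 give the
    term in z and those with j_m > 2 give B(q, zt, tq). *)

(** * Pattern statistics of words and the decomposition at the maximum *)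

Section Words.
Local Open Scope nat_scope.
Implicit Types (u v w : seq nat) (x n d : nat).

Fixpoint word12 w : nat :=
  if w is x :: w' then count (fun y => x < y) w' + word12 w' else 0.

(** The 123 patterns that start at [x] are the 12 patterns among the later letters larger than
    [x]. *)
Fixpoint word123 w : nat :=
  if w is x :: w' then word12 [seq y <- w' | x < y] + word123 w' else 0.

(** A 132 pattern that starts at [x] is a descending pair among the later letters larger than
    [x]. *)
Fixpoint word_avoids132 w : bool :=
  if w is x :: w' then
    pairwise leq [seq y <- w' | x < y] && word_avoids132 w'
  else true.

Section Join.
Variables (N : nat) (v : seq nat).
Hypothesis vN : all (fun y => y < N) v.

Lemma filter_gt_join x u : all (fun y => y <= x) v -> x < N ->
  [seq y <- u ++ N :: v | x < y] = rcons [seq y <- u | x < y] N.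
Proof.
move=> vx xN; rewrite filter_cat /= xN -cats1; congr (_ ++ _ :: _).
apply/eqP; rewrite -[_ == _]negbK -has_filter; apply/hasPn => y yv.
by rewrite -leqNgt (allP vx).
Qed.

Lemma filter_gt_max : [seq y <- v | N < y] = [::].
Proof.
apply/eqP; rewrite -[_ == _]negbK -has_filter; apply/hasPn => y yv.
by rewrite -leqNgt ltnW // (allP vN).
Qed.

Lemma word12_rcons u : all (fun y => y < N) u ->
  word12 (rcons u N) = word12 u + size u.
Proof.
elim: u => //= x u IH /andP[xN uN]; rewrite IH // -cats1 count_cat /= xN.
by lia.
Qed.

(** A pair from [u] to [v] never ascends, and [N] exceeds everything after it. Hence the only new
    ascending pairs end at [N], one for each letter of [u]. *)
Lemma word12_join u : all (fun y => y < N) u ->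
  allrel (fun x y => y <= x) u v ->
  word12 (u ++ N :: v) = word12 u + size u + word12 v.
Proof.
elim: u => [|x u IH] /=; first by rewrite -size_filter filter_gt_max.
move=> /andP[xN uN]; rewrite allrel_consl => /andP[vx uv].
by rewrite IH // -!size_filter filter_gt_join // size_rcons; lia.
Qed.

(** A 123 pattern not contained in [u] or in [v] must end at [N], so its first two letters form a 12
    pattern of [u]. *)
Lemma word123_join u : all (fun y => y < N) u ->
  allrel (fun x y => y <= x) u v ->
  word123 (u ++ N :: v) = word123 u + word12 u + word123 v.
Proof.
elim: u => [|x u IH] /=; first by rewrite filter_gt_max.
move=> /andP[xN uN]; rewrite allrel_consl => /andP[vx uv].
rewrite IH // filter_gt_join // word12_rcons ?size_filter; first by lia.
by apply/allP => y; rewrite mem_filter => /andP[_ /(allP uN)].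
Qed.

(** If [x] in [u] is smaller than [y] in [v], then [x], [N], [y] is a 132 pattern. If there is no
    such pair, every 132 pattern lies within [u] or within [v]. *)
Lemma word_avoids132_join u : all (fun y => y < N) u -> N \notin v ->
  word_avoids132 (u ++ N :: v)
    = [&& allrel (fun x y => y <= x) u v, word_avoids132 u & word_avoids132 v].
Proof.
move=> + Nv; elim: u => [|x u IH] /=; first by rewrite filter_gt_max.
move=> /andP[xN uN]; rewrite IH // allrel_consl.
have [vx|] := boolP (all (fun y => y <= x) v).
  rewrite filter_gt_join // -cats1 pairwise_cat /= andbT allrel1r.
  rewrite (_ : all _ _ = true) /=; last first.
    by apply/allP => y; rewrite mem_filter => /andP[_ /(allP uN) /ltnW].
  by rewrite -!andbA; do !bool_congr; rewrite andbC.
rewrite -has_predC => /hasP[y yv /= yx]; rewrite filter_cat pairwise_cat /= xN /=.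
suff -> : all (leq N) [seq y <- v | x < y] = false by rewrite !andbF.
apply/negbTE/allPn; exists y; first by rewrite mem_filter ltnNge yx.
by rewrite -ltnNge (allP vN).
Qed.

End Join.

Lemma filter_gt_shift d x u :
  [seq y <- map (addn d) u | d + x < y] = map (addn d) [seq y <- u | x < y].
Proof. by rewrite filter_map; congr map; apply: eq_filter => y /=; lia. Qed.

Lemma word12_shift d u : word12 (map (addn d) u) = word12 u.
Proof.
elim: u => //= x u IH.
by rewrite IH -!size_filter filter_gt_shift size_map.
Qed.

Lemma word123_shift d u : word123 (map (addn d) u) = word123 u.
Proof. by elim: u => //= x u IH; rewrite IH filter_gt_shift word12_shift. Qed.

Lemma word_avoids132_shift d u : word_avoids132 (map (addn d) u) = word_avoids132 u.
Proof.
elim: u => //= x u IH; rewrite IH filter_gt_shift pairwise_map.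
by congr (_ && _); apply: eq_pairwise => y z /=; rewrite leq_add2l.
Qed.

Definition perms132 n : seq (seq nat) :=
  [seq w <- permutations (iota 0 n) | word_avoids132 w].

Lemma perms132_uniq n : uniq (perms132 n).
Proof. by rewrite filter_uniq // permutations_uniq. Qed.

Lemma mem_perms132 n w :
  (w \in perms132 n) = perm_eq w (iota 0 n) && word_avoids132 w.
Proof. by rewrite mem_filter mem_permutations andbC. Qed.

Lemma size_perms132 n w : w \in perms132 n -> size w = n.
Proof. by rewrite mem_perms132 => /andP[/perm_size -> _]; rewrite size_iota. Qed.

Lemma perms132_lt n w : w \in perms132 n -> all (fun y => y < n) w.
Proof.
rewrite mem_perms132 => /andP[/perm_mem wE _]; apply/allP => y.
by rewrite wE mem_iota.
Qed.

(** With [d] the length of [v], the shift lifts the letters of [u] above those of [v]; [n] is the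
    new maximum. *)
Definition join132 d n u v := map (addn d) u ++ n :: v.

(* In a 132-avoiding word every letter before the maximum is larger than every
   letter after it, so the two parts are permutations of intervals. *)
Lemma split_max u v n : perm_eq (u ++ n :: v) (iota 0 n.+1) ->
  allrel (fun x y => y <= x) u v ->
  perm_eq v (iota 0 (size v)) /\ perm_eq u (iota (size v) (size u)).
Proof.
move=> uv_perm uv.
have uvE : perm_eq (v ++ u) (iota 0 (size v + size u)).
  have -> : size v + size u = n.
    by have := perm_size uv_perm; rewrite size_cat size_iota /=; lia.
  rewrite perm_catC -(perm_cons n); apply: perm_trans (perm_trans _ uv_perm) _.
    by rewrite -cat1s perm_catCA.
  by rewrite -addn1 iotaD add0n cats1 perm_rcons.
(* Both sides are sorted rearrangements of the same letters, since [v] lies below [u]. Cutting them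
   after [size v] letters identifies each part. *)
have : sort leq v ++ sort leq u = iota 0 (size v + size u).
  apply: (sorted_eq leq_trans anti_leq).
  - rewrite sorted_pairwise; last exact: leq_trans.
    rewrite pairwise_cat -!sorted_pairwise; try exact: leq_trans.
    rewrite !(sort_sorted leq_total) !andbT allrelC.
    apply/allrelP => x y; rewrite !mem_sort => xu yv.
    exact: (allrelP uv).
  - exact: iota_sorted.
  - by apply: perm_trans uvE; apply: perm_cat; rewrite perm_sort.
rewrite iotaD add0n => /eqP; rewrite eqseq_cat ?size_sort ?size_iota //.
case/andP => /eqP vE /eqP uE; split.
  by rewrite -vE perm_sym perm_sort.
by rewrite -uE perm_sym perm_sort.
Qed.

(** The position [i] of the maximum is the length of the left part. Once [i] is fixed, joining is
    injective on pairs, and by [split_max] it reaches every avoiding word. *)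
Lemma perms132_split n i : i <= n ->
  perm_eq [seq w <- perms132 n.+1 | index n w == i]
    [seq join132 (n - i) n u v | u <- perms132 i, v <- perms132 (n - i)].
Proof.
move=> le_in; apply: uniq_perm; first by rewrite filter_uniq ?perms132_uniq.
  apply: allpairs_uniq; rewrite ?perms132_uniq // => -[u v] [u' v'].
  case/allpairsP => -[a b] /= [ua vb [-> ->]].
  case/allpairsP => -[a' b'] /= [ua' vb' [-> ->]].
  have saa' : size a = size a' by rewrite (size_perms132 ua) (size_perms132 ua').
  move/eqP; rewrite /= eqseq_cat ?size_map //.
  by case/andP => /eqP /(inj_map (@addnI _)) -> /eqP[->].
move=> w; rewrite mem_filter; apply/andP/allpairsP; last first.
  case=> -[u v] /= [uP vP ->].
  have uN : all (fun y => y < n) (map (addn (n - i)) u).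
    rewrite all_map; apply: sub_all (perms132_lt uP) => y /=; lia.
  have vN : all (fun y => y < n) v.
    by apply: sub_all (perms132_lt vP) => y /=; lia.
  split.
    rewrite /join132 index_cat ifN /=; last first.
      by apply/negP => /(allP uN); rewrite ltnn.
    by rewrite eqxx addn0 size_map (size_perms132 uP).
  move: (uP) (vP); rewrite !mem_perms132 => /andP[uE uA] /andP[vE vA].
  rewrite word_avoids132_join //; last by apply/negP => /(allP vN); rewrite ltnn.
  rewrite word_avoids132_shift uA vA !andbT; apply/andP; split.
    rewrite -addn1 iotaD add0n cats1 perm_sym perm_rcons perm_sym.
    rewrite perm_catC /= perm_cons.
    rewrite -{2}(subnK le_in) iotaD add0n; apply: perm_cat => //.
    by rewrite -[X in iota X]addn0 iotaDl perm_map.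
  apply/allrelP => x y /mapP[x' _ ->] /(allP (perms132_lt vP)) /=; lia.
move=> [/eqP wi]; rewrite mem_perms132 => /andP[wE wA].
have nw : n \in w by rewrite (perm_mem wE) mem_iota; lia.
have w_uniq : uniq w by rewrite (perm_uniq wE) iota_uniq.
case/splitPr: nw wi wE wA w_uniq => u v wi wE wA.
rewrite uniq_catC /= mem_cat negb_or -andbA => /and3P[nv nu _].
have lt_n x : x \in u ++ v -> x < n.
  move=> xuv; have : x \in u ++ n :: v.
    by move: xuv; rewrite !mem_cat inE orbCA => ->; rewrite orbT.
  rewrite (perm_mem wE) mem_iota => /andP[_]; rewrite add0n ltnS leq_eqVlt.
  by case: eqP xuv => // ->; rewrite mem_cat (negbTE nu) (negbTE nv).
have uN : all (fun y => y < n) u by apply/allP => x xu; rewrite lt_n ?mem_cat ?xu.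
have vN : all (fun y => y < n) v.
  by apply/allP => x xv; rewrite lt_n ?mem_cat ?xv ?orbT.
move: wA; rewrite word_avoids132_join // => /and3P[uv uA vA].
have [vE uE] := split_max wE uv.
move: wi; rewrite index_cat (negbTE nu) /= eqxx addn0 => su.
have sv : size v = n - i.
  by have := perm_size wE; rewrite size_cat size_iota /=; lia.
(* The letters of [u] are at least [n - i], so the truncated subtraction is inverted by the
   shift. *)
have uK : map (addn (n - i)) (map (subn^~ (n - i)) u) = u.
  rewrite -map_comp map_id_in // => x; rewrite (perm_mem uE) mem_iota sv /=; lia.
exists (map (subn^~ (n - i)) u, v); rewrite /= /join132 uK; split => //.
  rewrite mem_perms132 -(word_avoids132_shift (n - i)) uK uA andbT.
  by apply: (perm_map_inj (@addnI (n - i))); rewrite uK -iotaDl addn0 -sv -su.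
by rewrite mem_perms132 vA -sv vE.
Qed.

End Words.

(** * From permutations to words in one-line notation *)

Section PermutationWords.
Local Open Scope nat_scope.
Implicit Types (w : seq nat) (p : pred nat).

Lemma count_sum_nth p w : count p w = \sum_(0 <= i < size w) p (nth 0 w i).
Proof. by rewrite -sum1_count (big_nth 0) big_mkcond. Qed.

(** The filter is kept in the statement because [word123] evaluates [word12] on filtered tails. *)
Lemma word12_filter p w : word12 [seq y <- w | p y] =
  \sum_(0 <= i < size w) \sum_(0 <= j < size w)
    [&& i < j, p (nth 0 w i), p (nth 0 w j) & nth 0 w i < nth 0 w j].
Proof.
elim: w => [|x w IH]; first by rewrite big_nil.
rewrite /= big_nat_recl // big_nat_recl //= add0n.
under [X in _ = _ + X]eq_bigr => i _ do rewrite big_nat_recl //= add0n.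
rewrite -IH; case: (p x) => /=; last by rewrite big1.
congr (_ + _); rewrite count_filter count_sum_nth.
by apply: eq_bigr => i _ /=; rewrite andbC.
Qed.

Lemma word12E w : word12 w =
  \sum_(0 <= i < size w) \sum_(0 <= j < size w)
    ((i < j) && (nth 0 w i < nth 0 w j)).
Proof. by rewrite -[in LHS](filter_predT w) word12_filter. Qed.

Lemma word123E w : word123 w =
  \sum_(0 <= i < size w) \sum_(0 <= j < size w) \sum_(0 <= k < size w)
    [&& i < j, j < k, nth 0 w i < nth 0 w j & nth 0 w j < nth 0 w k].
Proof.
elim: w => [|x w IH]; first by rewrite big_nil.
rewrite /= big_nat_recl // big_nat_recl //= [X in _ = X + _ + _]big1 // add0n.
rewrite IH word12_filter; congr (_ + _).
  apply: eq_bigr => i _; rewrite big_nat_recl //= add0n; apply: eq_bigr => j _ /=.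
  congr (nat_of_bool _); rewrite ltnS; case: (_ < _) => //=.
  by apply/idP/idP; lia.
apply: eq_bigr => i _; rewrite big_nat_recl //= [X in _ = X + _]big1 ?add0n //.
by apply: eq_bigr => j _; rewrite big_nat_recl //= andbF add0n.
Qed.

Lemma pairwise_filterP p w :
  reflect (forall i j, i < j < size w -> p (nth 0 w i) -> p (nth 0 w j) ->
             nth 0 w i <= nth 0 w j)
    (pairwise leq [seq y <- w | p y]).
Proof.
elim: w => [|x w IH] /=; first by apply: (iffP idP) => // _ i j /andP[].
have [px|npx] /= := boolP (p x); last first.
  apply: (iffP IH) => wP; last by move=> i j; apply: (wP i.+1 j.+1).
  by move=> [|i] [|j] //=; [rewrite (negbTE npx) | apply: wP].
apply: (iffP andP) => [[/allP xw /IH wP] [|i] [|j] //= ij pi pj|wP].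
- by apply: xw; rewrite mem_filter pj mem_nth.
- exact: wP.
split; last by apply/IH => i j; apply: (wP i.+1 j.+1).
apply/allP => y; rewrite mem_filter => /andP[py /(nthP 0) [j jw jE]].
by rewrite -jE; apply: (wP 0 j.+1); rewrite //= jE.
Qed.

Lemma word_avoids132P w :
  reflect (forall i j k, i < j -> j < k < size w ->
             nth 0 w i < nth 0 w k -> ~~ (nth 0 w k < nth 0 w j))
    (word_avoids132 w).
Proof.
elim: w => [|x w IH] /=; first by apply: (iffP idP) => // _ i j k _ /andP[].
apply: (iffP andP) => [[/pairwise_filterP xw /IH wP] [|i] [|j] [|k] //= ij jk|wP].
- rewrite -leqNgt => xk; have [|/ltnW] := leqP (nth 0 w j) x.
    by move=> jx; apply: leq_trans jx (ltnW xk).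
  by move=> xj; have := xw j k jk; rewrite xk; lia.
- exact: wP.
split; last by apply/IH => i j k ij jk; apply: (wP i.+1 j.+1 k.+1).
apply/pairwise_filterP => j k jk xj xk; rewrite leqNgt.
exact: (wP 0 j.+1 k.+1).
Qed.

Section OnePermutation.
Variables (n : nat) (s : 'S_n).

Definition perm_word : seq nat := [seq val (s i) | i <- enum 'I_n].

Lemma size_perm_word : size perm_word = n.
Proof. by rewrite size_map size_enum_ord. Qed.

Lemma nth_perm_word (i : 'I_n) : nth 0 perm_word i = s i.
Proof. by rewrite (nth_map i) ?size_enum_ord // nth_ord_enum. Qed.

Lemma num12_word : num12 s = word12 perm_word.
Proof.
rewrite /num12 -sum1dep_card big_mkcond word12E size_perm_word big_mkord.
rewrite -(pair_bigA _ (fun i j : 'I_n => if (i < j) && (s i < s j) then 1 else 0)).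
apply: eq_bigr => i _; rewrite big_mkord; apply: eq_bigr => j _.
by rewrite !nth_perm_word; case: ifP.
Qed.

Lemma num123_word : num123 s = word123 perm_word.
Proof.
rewrite /num123 -sum1dep_card big_mkcond word123E size_perm_word big_mkord.
rewrite -(pair_bigA _ (fun (p : 'I_n * 'I_n) (k : 'I_n) =>
  if [&& p.1 < p.2, p.2 < k, s p.1 < s p.2 & s p.2 < s k] then 1 else 0)) /=.
rewrite -(pair_bigA _ (fun (i j : 'I_n) => \sum_(k < n)
  if [&& i < j, j < k, s i < s j & s j < s k] then 1 else 0)) /=.
apply: eq_bigr => i _; rewrite big_mkord; apply: eq_bigr => j _.
rewrite big_mkord; apply: eq_bigr => k _.
by rewrite !nth_perm_word; case: ifP.
Qed.

Lemma avoids132_word : avoids132 s = word_avoids132 perm_word.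
Proof.
apply/idP/word_avoids132P; rewrite size_perm_word.
  move=> sA i j k ij /andP[jk kn].
  have jn := ltn_trans jk kn; have li := ltn_trans ij jn.
  rewrite (nth_perm_word (Ordinal li)) (nth_perm_word (Ordinal jn)).
  rewrite (nth_perm_word (Ordinal kn)) => ik; apply: contra sA => kj.
  apply/existsP; exists (Ordinal li); apply/existsP; exists (Ordinal jn).
  by apply/existsP; exists (Ordinal kn); apply/and4P.
move=> wA; apply/existsP => -[i /existsP[j /existsP[k /and4P[ij jk ik kj]]]].
have := wA i j k ij; rewrite jk ltn_ord !nth_perm_word kj.
by move=> /(_ isT ik).
Qed.

End OnePermutation.

Lemma perm_word_inj n : injective (@perm_word n).
Proof.
move=> s s' ss'; apply/permP => i; apply: val_inj.
by rewrite /= -!nth_perm_word ss'.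
Qed.

(** One-line notations are pairwise distinct rearrangements of [iota 0 n], and there are n! of both,
    so the inclusion is an equality. *)
Lemma perm_words n :
  perm_eq [seq perm_word s | s : 'S_n] (permutations (iota 0 n)).
Proof.
have [|||_ wE] :=
  @uniq_min_size _ [seq perm_word s | s : 'S_n] (permutations (iota 0 n)).
- by rewrite map_inj_uniq ?enum_uniq //; apply: perm_word_inj.
- move=> w /mapP[s _ ->]; rewrite mem_permutations.
  rewrite /perm_word (map_comp val s) -val_enum_ord; apply: perm_map.
  apply: uniq_perm; 
    [by rewrite (map_inj_uniq (@perm_inj _ s)) enum_uniq | exact: enum_uniq |].
  move=> i; rewrite mem_enum; apply/mapP; exists (s^-1%g i); rewrite ?mem_enum //.
  by rewrite permKV.
- by rewrite size_permutations ?iota_uniq // size_iota size_map -cardE card_Sn leqnn.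
apply: uniq_perm => //; last exact: permutations_uniq.
by rewrite map_inj_uniq ?enum_uniq //; apply: perm_word_inj.
Qed.

Lemma sum_avoids132 (R : nmodType) n (F : seq nat -> R) :
  (\sum_(s : 'S_n | avoids132 s) F (perm_word s) = \sum_(w <- perms132 n) F w)%R.
Proof.
rewrite big_filter -(perm_big _ (perm_words n)) big_map enumT.
by apply: eq_bigl => s; rewrite avoids132_word.
Qed.

End PermutationWords.

(** * Power series: coefficient formulas and substitutions *)

Section SeriesOperators.
Variable R : comNzRingType.
Implicit Types (f g : {fps R}) (c : R).

Lemma fpsB f g n : (f - g) n = f n - g n. Proof. by []. Qed.

Lemma fpsD f g n : (f + g) n = f n + g n. Proof. by []. Qed.

Lemma fps1 n : (1 : {fps R}) n = (n == 0%N)%:R.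
Proof. by rewrite /=; case: (n == 0%N). Qed.

Lemma fpsM f g n : (f * g) n = \sum_(i < n.+1) f i * g (n - i)%N.
Proof. by []. Qed.

Lemma fps_constM c f n : (fps_const c * f) n = c * f n.
Proof.
rewrite [LHS]/= big_ord_recl /= subn0 big1 ?addr0 // => i _.
by rewrite mul0r.
Qed.

Lemma fps_const_is_monoid_morphism : monoid_morphism (@fps_const R).
Proof.
split=> [//|c d]; apply: fpsP => n; rewrite fps_constM /=.
by case: ifP; rewrite ?mulr0.
Qed.

Lemma fps_const_is_zmod_morphism : zmod_morphism (@fps_const R).
Proof. by move=> c d; apply: fpsP => n /=; case: ifP; rewrite ?subrr. Qed.

HB.instance Definition _ :=
  GRing.isZmodMorphism.Build R {fps R} (@fps_const R) fps_const_is_zmod_morphism.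
HB.instance Definition _ :=
  GRing.isMonoidMorphism.Build R {fps R} (@fps_const R)
    fps_const_is_monoid_morphism.

Lemma fps_XM f n : (fps_X R * f) n = if n is k.+1 then f k else 0.
Proof.
rewrite [LHS]/= big_ord_recl /= mul0r add0r; case: n => [|k] /=.
  by rewrite big_ord0.
rewrite big_ord_recl /= mul1r subSS subn0 big1 ?addr0 // => i _.
by rewrite mul0r.
Qed.

Lemma fps_XnM k f n : (fps_X R ^+ k * f) n = if (n < k)%N then 0 else f (n - k)%N.
Proof.
elim: k n => [|k IH] n; first by rewrite expr0 mul1r subn0.
by rewrite exprS -mulrA fps_XM; case: n => [|n].
Qed.

Lemma fps_dilateE c f n : fps_dilate c f n = c ^+ n * f n. Proof. by []. Qed.

Lemma fps_dilate_is_zmod_morphism c : zmod_morphism (@fps_dilate R c).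
Proof. by move=> f g; apply: fpsP => n; rewrite /= mulrBr. Qed.

Lemma fps_dilate_is_monoid_morphism c : monoid_morphism (@fps_dilate R c).
Proof.
split=> [|f g]; apply: fpsP => n; rewrite fps_dilateE.
  by rewrite fps1; case: n => [|n]; rewrite ?expr0 ?mul1r ?mulr0.
rewrite mulr_sumr; apply: eq_bigr => i _ /=.
by rewrite mulrACA -exprD subnKC // -ltnS.
Qed.

HB.instance Definition _ c :=
  GRing.isZmodMorphism.Build {fps R} {fps R} (@fps_dilate R c)
    (fps_dilate_is_zmod_morphism c).
HB.instance Definition _ c :=
  GRing.isMonoidMorphism.Build {fps R} {fps R} (@fps_dilate R c)
    (fps_dilate_is_monoid_morphism c).

End SeriesOperators.

Section MapSeries.
Variables (R S : comNzRingType) (h : {rmorphism R -> S}).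

Lemma fps_map_is_zmod_morphism : zmod_morphism (@fps_map R S h).
Proof. by move=> f g; apply: fpsP => n; rewrite /= rmorphB. Qed.

Lemma fps_map_is_monoid_morphism : monoid_morphism (@fps_map R S h).
Proof.
split=> [|f g]; apply: fpsP => n /=; first by case: ifP; rewrite ?rmorph1 ?rmorph0.
by rewrite rmorph_sum; apply: eq_bigr => i _; rewrite rmorphM.
Qed.

End MapSeries.

Section Substitution.
Variables (u : {fps Qq}) (c : Qq).
Implicit Types F G : {fps {fps Qq}}.

Lemma subst_ztE F n : subst_zt u c F n = u ^+ n * fps_dilate c (F n).
Proof. by []. Qed.

Lemma subst_ztB F G : subst_zt u c (F - G) = subst_zt u c F - subst_zt u c G.
Proof. by rewrite /subst_zt fps_map_is_zmod_morphism rmorphB. Qed.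

Lemma subst_ztM F G : subst_zt u c (F * G) = subst_zt u c F * subst_zt u c G.
Proof. by rewrite /subst_zt (fps_map_is_monoid_morphism _).2 rmorphM. Qed.

End Substitution.

Lemma dilate_t c : fps_dilate c t = qc c * t.
Proof.
apply: fpsP => n; rewrite fps_constM /=.
by case: n => [|[|n]]; rewrite ?mulr0 ?expr1.
Qed.

Lemma dilate_qc c d : fps_dilate c (qc d) = qc d.
Proof. by apply: fpsP => -[|n] /=; rewrite ?expr0 ?mul1r ?mulr0. Qed.

(** Weight of a joined word, with [x] for q and [y] for t: [a], [b] count the 123 and 12 patterns of
    the left part, [c], [d] those of the right part, and [i] is the length of the left part. *)
Lemma rmorph_weight (A C : comNzRingType) (h : {rmorphism A -> C}) x y a b c d i :
  h (x ^+ (a + b + c)) * y ^+ (b + i + d)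
    = y ^+ i * (h (x ^+ a) * (h x * y) ^+ b) * (h (x ^+ c) * y ^+ d).
Proof. by rewrite !rmorphXn /= !exprD exprMn; ring. Qed.

Local Notation substS := (subst_zt t q).

(** Applying S twice sends z to zt and then to (zt)(tq) = t^2 q z, and t to tq^2. The equation of B
    thus reads B = S B - z S(S B). *)
Lemma subst_twice F : substS (substS F) = subst_zt (t ^+ 2 * qc q) (q ^+ 2) F.
Proof.
apply: fpsP => n; rewrite !subst_ztE rmorphM rmorphXn /= dilate_t mulrA.
have -> : fps_dilate q (fps_dilate q (F n)) = fps_dilate (q ^+ 2) (F n).
  by apply: fpsP => k; rewrite !fps_dilateE mulrA -exprMn expr2.
by rewrite -exprMn mulrCA -expr2 [qc q * _]mulrC.
Qed.

(** The factor z makes each coefficient of [F] depend only on coefficients of lower degree in z, so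
    all vanish by strong induction. *)
Lemma zM_eq_rec (F G : {fps {fps Qq}}) : F = z * (G * substS F) -> F = 0.
Proof.
move=> FE; apply: fpsP => n; rewrite [RHS]/= if_same.
elim/ltn_ind: n => -[|n] IH; rewrite FE fps_XM // fpsM big1 // => i _.
by rewrite subst_ztE IH ?rmorph0 ?mulr0 // ltnS leq_subr.
Qed.

(** * The functional equation of P and the ratio P = S B / B *)

Lemma P_coef0 : P 0%N = 1.
Proof.
pose s0 : 'S_0 := 1%g.
have sE (s : 'S_0) : s = s0 by apply/permP => -[].
rewrite [LHS]/= (big_pred1 s0) => [|s]; last first.
  rewrite /= (sE s) eqxx; apply/existsP => -[[]] //.
rewrite num12_word num123_word /perm_word.
by rewrite (size0nil (size_enum_ord 0)) /= mulr1.
Qed.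

Lemma P_word n :
  P n = \sum_(w <- perms132 n) qc (q ^+ word123 w) * t ^+ word12 w.
Proof.
rewrite -(sum_avoids132 n (fun w => qc (q ^+ word123 w) * t ^+ word12 w)) /=.
by apply: eq_bigr => s _; rewrite num12_word num123_word.
Qed.

(** Sorting words by the position [i] of the maximum gives the Cauchy product. The contributions of
    the maximum, t^i and q^12(u), are those that S adds to the left factor. *)
Lemma P_functional : P = 1 + z * (substS P * P).
Proof.
apply: fpsP => -[|n]; rewrite fpsD fps_XM fps1 ?P_coef0 ?addr0 //.
rewrite [X in X + _](_ : _ = 0) // add0r fpsM.
under [RHS]eq_bigr => i _ do rewrite subst_ztE !P_word.
(* [inord] only casts the index to an ordinal: [n] occurs in every word of the sum, so its index is
   at most [n]. *)
rewrite P_word (partition_big (fun w => inord (index n w) : 'I_n.+1) predT) //=.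
apply: eq_bigr => i _.
have le_in : (i <= n)%N by rewrite -ltnS.
transitivity (\sum_(w <- [seq w <- perms132 n.+1 | index n w == i])
   qc (q ^+ word123 w) * t ^+ word12 w).
  rewrite big_filter big_seq_cond [RHS]big_seq_cond; apply: eq_bigl => w.
  case wP: (w \in _) => //=; rewrite -val_eqE /= inordK //.
  rewrite -(size_perms132 wP) index_mem.
  by move: wP; rewrite mem_perms132 => /andP[/perm_mem -> _]; rewrite mem_iota /= add0n.
rewrite (perm_big _ (perms132_split le_in)) big_allpairs_dep /=.
rewrite rmorph_sum [t ^+ _ * _]mulr_sumr mulr_suml; apply: eq_big_seq => u uP.
rewrite mulr_sumr; apply: eq_big_seq => v vP.
have uN : all (fun y => y < n)%N (map (addn (n - i)) u).
  rewrite all_map; apply: sub_all (perms132_lt uP) => y /=; lia.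
have vN : all (fun y => y < n)%N v.
  by apply: sub_all (perms132_lt vP) => y /=; lia.
have uv : allrel (fun x y => y <= x)%N (map (addn (n - i)) u) v.
  apply/allrelP => x y /mapP[x' _ ->] /(allP (perms132_lt vP)) /=; lia.
rewrite /join132 word12_join // word123_join // word12_shift word123_shift.
rewrite size_map (size_perms132 uP) rmorphM /= dilate_qc rmorphXn /= dilate_t.
exact: (rmorph_weight (@fps_const Qq)).
Qed.

Lemma denominator_ratio B : is_denominator B -> P * B = subst_zt t q B.
Proof.
case=> _ BE; rewrite -subst_twice in BE.
apply/eqP; rewrite -subr_eq0; apply/eqP; apply: (@zM_eq_rec _ P).
rewrite subst_ztB subst_ztM.
have zSS : z * substS (substS B) = substS B - B by rewrite {3}BE; ring.
have zPSP : z * (substS P * P) = P - 1 by rewrite {3}P_functional; ring.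
(* This is D = z P (S D) as a ring identity: [x], [p], [sp], [b], [sb], [ssb] stand for z, P, S P,
   B, S B, S(S B). *)
have E (R : comNzRingType) (x p sp b sb ssb : R) :
  p * (x * ssb) = p * (sb - b) -> x * (sp * p) = p - 1 ->
  p * b - sb = x * (p * (sp * sb - ssb)).
  move=> h1 h2; have -> : x * (p * (sp * sb - ssb)) = x * (sp * p) * sb - p * (x * ssb).
    by ring.
  by rewrite h1 h2; ring.
by apply: E => //; rewrite zSS.
Qed.

(** * Coefficient recursion and uniqueness of the denominator *)

Lemma fps_X2constXM (R : comNzRingType) (c : R) m (f : {fps R}) n :
  ((fps_X R ^+ 2 * fps_const c) ^+ m * f) n
    = if (n < 2 * m)%N then 0 else c ^+ m * f (n - 2 * m)%N.
Proof. by rewrite exprMn -exprM -rmorphXn -mulrA fps_XnM fps_constM. Qed.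

(** In degree m+1 in z the two terms are t^(m+1) phi_{m+1}(tq) and (t^2 q)^m phi_m(tq^2). The guards
    on [n] express the shifts by t^(m+1) and t^(2m). *)
Lemma denominator_coefP (B : {fps {fps Qq}}) : is_denominator B <->
  B 0%N = 1 /\ forall m n, B m.+1 n =
    (if (n < m.+1)%N then 0 else q ^+ (n - m.+1) * B m.+1 (n - m.+1)%N)
    - (if (n < 2 * m)%N then 0
       else q ^+ m * ((q ^+ 2) ^+ (n - 2 * m) * B m (n - 2 * m)%N)).
Proof.
have E m n : (subst_zt t q B - z * subst_zt (t ^+ 2 * qc q) (q ^+ 2) B) m.+1 n =
    (if (n < m.+1)%N then 0 else q ^+ (n - m.+1) * B m.+1 (n - m.+1)%N)
    - (if (n < 2 * m)%N then 0
       else q ^+ m * ((q ^+ 2) ^+ (n - 2 * m) * B m (n - 2 * m)%N)).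
  by rewrite !fpsB fps_XM !subst_ztE fps_XnM fps_X2constXM !fps_dilateE.
split=> -[B0 BE]; split=> //; first by move=> m n; rewrite {1}BE E.
apply: fpsP => -[|m]; last by apply: fpsP => n; rewrite E -BE.
by rewrite fpsB fps_XM subst_ztE B0 rmorph1 expr0 mulr1 subr0.
Qed.

(** The recursion refers to phi_m and to phi_{m+1} in t-degree lower by m+1 > 0. Induction on [m],
    then strong induction on [n], determines everything. *)
Lemma denominator_uniq B C : is_denominator B -> is_denominator C -> B = C.
Proof.
move=> /denominator_coefP[B0 BE] /denominator_coefP[C0 CE].
apply: fpsP => m; apply: fpsP => n; elim: m n => [|m IHm] n; first by rewrite B0 C0.
elim/ltn_ind: n => n IHn; rewrite BE CE; congr (_ - _); last by rewrite IHm.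
by case: ltnP => // mn; rewrite IHn // -subn_gt0 subKn.
Qed.

(** * Exponent tuples: effect of changing or appending the last entry *)

Section Exponents.
Variable m : nat.
Implicit Types (j : {ffun 'I_m -> nat}) (x : nat).

(** [insub] fails only at the last ordinal, where the default [x] is taken. *)
Definition ffun_rcons j x : {ffun 'I_m.+1 -> nat} :=
  [ffun r => oapp j x (insub (val r))].

Lemma ffun_rcons_widen j x r : ffun_rcons j x (widen_ord (leqnSn m) r) = j r.
Proof. by rewrite ffunE /= valK. Qed.

Lemma ffun_rcons_max j x : ffun_rcons j x ord_max = x.
Proof. by rewrite ffunE insubF //= ltnn. Qed.

Lemma ffun_rconsP (j' : {ffun 'I_m.+1 -> nat}) :
  exists j x, j' = ffun_rcons j x.
Proof.
exists [ffun r => j' (widen_ord (leqnSn m) r)], (j' ord_max).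
apply/ffunP => r; rewrite ffunE; case: insubP => [r' _ r'E|rm] /=.
  by rewrite ffunE; congr (j' _); apply: val_inj.
congr (j' _); apply: val_inj => /=; apply/eqP.
by rewrite eqn_leq -ltnS ltn_ord leqNgt.
Qed.

Lemma ffun_rcons_inj j k x y : ffun_rcons j x = ffun_rcons k y -> j = k /\ x = y.
Proof.
move=> E; split; last by rewrite -(ffun_rcons_max j x) E ffun_rcons_max.
by apply/ffunP => r; rewrite -(ffun_rcons_widen j x) E ffun_rcons_widen.
Qed.

Lemma ffun_rcons_ge2 j x :
  (forall r, (2 <= ffun_rcons j x r)%N) <-> (forall r, (2 <= j r)%N) /\ (2 <= x)%N.
Proof.
split=> [jx|[j2 x2] r].
  split=> [r|]; first by rewrite -(ffun_rcons_widen j x).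
  by rewrite -(ffun_rcons_max j x).
by rewrite ffunE; case: insubP => [r' _ _|_] /=.
Qed.

Lemma weight_rcons j x : weight (ffun_rcons j x) = (weight j + m.+1 * x)%N.
Proof.
rewrite /weight big_ord_recr /= ffun_rcons_max; congr (_ + _)%N.
by apply: eq_bigr => r _; rewrite ffun_rcons_widen.
Qed.

(** The new index m+1 is the largest, so min(r, m+1) = r: the cross terms give [x * weight j] twice
    and the diagonal gives (m+1) x^2. *)
Lemma min_form_rcons j x :
  min_form (ffun_rcons j x)
    = (min_form j + 2 * (x * weight j) + m.+1 * (x * x))%N.
Proof.
rewrite /min_form big_ord_recr /=.
under eq_bigr => r _ do rewrite big_ord_recr /= ffun_rcons_max.
rewrite big_ord_recr /= ffun_rcons_max minnn big_split /= -!addnA.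
congr (_ + _)%N.
  apply: eq_bigr => r _; apply: eq_bigr => s _.
  by rewrite !ffun_rcons_widen.
rewrite add0n mulnA; congr (_ + (_ + _))%N.
  rewrite /weight big_distrr /=; apply: eq_bigr => r _.
  by rewrite ffun_rcons_widen (minn_idPl _) ?ltnS 1?ltnW //; lia.
rewrite /weight big_distrr /=; apply: eq_bigr => r _.
by rewrite ffun_rcons_widen (minn_idPr _) ?ltnS 1?ltnW //; lia.
Qed.

(** The increment is the t-exponent of the term indexed by [ffun_rcons j x], which is exactly what
    replacing t by tq adds to the exponent of q. *)
Lemma half_exponent_rconsS j x :
  half_exponent (ffun_rcons j x.+1)
    = half_exponent (ffun_rcons j x)
      + (Posz (weight (ffun_rcons j x)) - Posz (2 * m.+1)).
Proof.
have := half_exponentE (ffun_rcons j x.+1); have := half_exponentE (ffun_rcons j x).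
rewrite !weight_rcons !min_form_rcons; lia.
Qed.

Lemma half_exponent_rcons2 j :
  half_exponent (ffun_rcons j 2)
    = half_exponent j + (Posz (2 * weight j) - Posz (3 * m.+1)).
Proof.
have := half_exponentE (ffun_rcons j 2); have := half_exponentE j.
rewrite !weight_rcons !min_form_rcons; lia.
Qed.

End Exponents.

(** * The explicit series satisfies the functional equation *)

Definition exponents_of_weight m w :=
  [set j : {ffun 'I_m -> nat} | (forall r, (2 <= j r)%N) /\ weight j = w].
Arguments exponents_of_weight : clear implicits.

Definition term_coef m (j : {ffun 'I_m -> nat}) : Qq :=
  (- q ^+ 3) ^+ m * q ^ half_exponent j.

(** Each r j_r is at least 2. Hence the prefactor t^(-2m) never leaves a negative power of t. *)
Lemma weight_ge m (j : {ffun 'I_m -> nat}) :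
  (forall r, (2 <= j r)%N) -> (2 * m <= weight j)%N.
Proof.
move=> j2; rewrite mulnC -[m in (m * 2)%N]card_ord -sum_nat_const.
by apply: leq_sum => r _; apply: leq_trans (j2 r) _; rewrite leq_pmull.
Qed.

Lemma exponents_of_small_weight m w :
  (w < 2 * m)%N -> exponents_of_weight m w = set0.
Proof.
move=> wm; apply/seteqP; split=> // j [/weight_ge + jw].
by rewrite jw leqNgt wm.
Qed.

(** Every entry is bounded by the weight, so there are finitely many tuples. *)
Lemma finite_exponents_of_weight m w : finite_set (exponents_of_weight m w).
Proof.
pose F (k : {ffun 'I_m -> 'I_w.+1}) : {ffun 'I_m -> nat} := [ffun r => val (k r)].
apply: (@sub_finite_set _ _ (F @` setT)); last by apply: finite_image.
move=> j [_ jw]; exists [ffun r => inord (j r)] => //.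
apply/ffunP => r; rewrite /F !ffunE /= inordK // ltnS -jw /weight (bigD1 r) //=.
by apply: leq_trans (leq_addr _ _); rewrite leq_pmull.
Qed.

(** The prefactor t^(-2m) turns weight n + 2m into degree n in t. *)
Definition denominator_series : {fps {fps Qq}} :=
  Fps (fun m => Fps (fun n =>
    \sum_(j \in exponents_of_weight m (n + 2 * m)) term_coef j)).

Lemma denominator_seriesE m n : denominator_series m n =
  \sum_(j \in exponents_of_weight m (n + 2 * m)) term_coef j.
Proof. by []. Qed.

Definition ffun_incr m (j : {ffun 'I_m.+1 -> nat}) : {ffun 'I_m.+1 -> nat} :=
  ffun_rcons [ffun r => j (widen_ord (leqnSn m) r)] (j ord_max).+1.

Lemma ffun_incr_rcons m (j : {ffun 'I_m -> nat}) x :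
  ffun_incr (ffun_rcons j x) = ffun_rcons j x.+1.
Proof.
rewrite /ffun_incr ffun_rcons_max; congr ffun_rcons.
by apply/ffunP => r; rewrite ffunE ffun_rcons_widen.
Qed.

(* Tuples with last entry > 2 arise by raising the last entry by one, those
   with last entry 2 by appending it. *)
Lemma exponents_of_weightS m n :
  exponents_of_weight m.+1 (n + 2 * m.+1)
    = (@ffun_incr m) @` exponents_of_weight m.+1 (n + m.+1)
      `|` (fun j => ffun_rcons j 2) @` exponents_of_weight m n.
Proof.
apply/seteqP; split=> [j' []|j' [] [j [j2 jw] <-]].
- have [j [x ->]] := ffun_rconsP j'; rewrite ffun_rcons_ge2 weight_rcons.
  case: x => [|[|[|x]]] [] // j2 _ jw.
    by right; exists j => //; split=> //; lia.
  left; exists (ffun_rcons j x.+2); last by rewrite ffun_incr_rcons.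
  by split; [rewrite ffun_rcons_ge2 | rewrite weight_rcons; lia].
- move: j2 jw; have [k [x ->]] := ffun_rconsP j.
  rewrite ffun_incr_rcons ffun_rcons_ge2 weight_rcons => -[k2 x2] kw.
  by split; [rewrite ffun_rcons_ge2; split=> //; lia | rewrite weight_rcons; lia].
- by split; [rewrite ffun_rcons_ge2 | rewrite weight_rcons; lia].
Qed.

Lemma q_neq0 : q != 0.
Proof. by rewrite tofrac_eq0 polyX_eq0. Qed.

Lemma term_coef_incr m (j : {ffun 'I_m.+1 -> nat}) n :
  (m < n)%N -> weight j = (n + m.+1)%N ->
  term_coef (ffun_incr j) = q ^+ (n - m.+1) * term_coef j.
Proof.
have [k [x ->]] := ffun_rconsP j; rewrite ffun_incr_rcons => mn jw.
rewrite /term_coef half_exponent_rconsS jw expfzDr ?q_neq0 //.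
rewrite mulrA [LHS]mulrC; congr (_ * _).
by rewrite -[q ^+ _]/(q ^ Posz _); congr (q ^ _); lia.
Qed.

Lemma term_coef_rcons2 m (j : {ffun 'I_m -> nat}) :
  (2 * m <= weight j)%N ->
  term_coef (ffun_rcons j 2)
    = - (q ^+ m * ((q ^+ 2) ^+ (weight j - 2 * m) * term_coef j)).
Proof.
rewrite /term_coef half_exponent_rcons2 => mw.
(* The exponent is split by origin: m comes from (t^2 q)^m, 2(weight - 2m) from t to tq^2, and -3
   cancels the additional factor q^3 of the prefactor. *)
have -> : Posz (2 * weight j) - Posz (3 * m.+1)
    = Posz (m + 2 * (weight j - 2 * m)) - 3%:Z by lia.
have E (K : fieldType) (x : K) (h : int) d : x != 0 ->
  (- x ^+ 3) ^+ m.+1 * x ^ (h + (Posz (m + 2 * d) - 3%:Z))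
    = - (x ^+ m * ((x ^+ 2) ^+ d * ((- x ^+ 3) ^+ m * x ^ h))).
  move=> x0; rewrite exprS !expfzDr // -exprnN -exprnP exprD exprM.
  by field.
exact: E q_neq0.
Qed.

Lemma denominator_series_is_denominator : is_denominator denominator_series.
Proof.
apply/denominator_coefP; split=> [|m n].
  apply: fpsP => n; rewrite fps1 /= addn0.
  (* For m = 0 the only tuple is the empty one, of weight 0 and coefficient 1. *)
  have [->|n0] /= := eqVneq n 0%N.
    rewrite (_ : exponents_of_weight 0 0 = [set [ffun=> 0%N]]).
      rewrite fsbig_set1 /term_coef expr0 mul1r.
      by rewrite /half_exponent /min_form /weight !big_ord0.
    apply/seteqP; split=> [j _|j _]; first by apply/ffunP => -[].
    by split=> [[]|]; rewrite // /weight big_ord0.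
  rewrite fsbig1 // => j [_]; rewrite /weight big_ord0 => n0'.
  by rewrite -n0' eqxx in n0.
rewrite !denominator_seriesE exponents_of_weightS fsbigU0.
- rewrite fsbig_image; last first.
    move=> j k _ _; have [j' [x ->]] := ffun_rconsP j.
    have [k' [y ->]] := ffun_rconsP k.
    by rewrite !ffun_incr_rcons => /ffun_rcons_inj[-> [->]].
  rewrite fsbig_image; last by move=> j k _ _ /ffun_rcons_inj[].
  congr (_ + _).
    (* If n < m+1, the weight n+m+1 is below the minimum 2(m+1), so the sum is empty, matching the
       zero branch. *)
    case: ltnP => mn.
      rewrite exponents_of_small_weight ?fsbig_set0 //; lia.
    rewrite mulr_fsumr (_ : (n - m.+1 + 2 * m.+1 = n + m.+1)%N); last by lia.
    apply: eq_fsbigr => j; rewrite inE => -[_ jw].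
    exact: term_coef_incr.
  case: ltnP => mn.
    by rewrite exponents_of_small_weight ?fsbig_set0 ?oppr0.
  rewrite subnK // mulrA -mulNr mulr_fsumr.
  apply: eq_fsbigr => j; rewrite inE => -[_ jw].
  by rewrite term_coef_rcons2 jw // mulNr mulrA.
- by apply: finite_image; apply: finite_exponents_of_weight.
- by apply: finite_image; apply: finite_exponents_of_weight.
(* The two images are disjoint: a raised last entry is at least 3, an appended one is 2. *)
move=> j [[k [k2 _] <-] [k' _]]; move: k2; have [k0 [x ->]] := ffun_rconsP k.
rewrite ffun_incr_rcons ffun_rcons_ge2 => -[_ x2] /ffun_rcons_inj[_ x1].
by move: x1 x2; lia.
Qed.

(** * The explicit series as a formal sum over all tuples *)

Lemma denominator_termE m (j : {ffun 'I_m -> nat}) n :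
  weight j = (n + 2 * m)%N ->
  denominator_term (existT _ m j) m (Posz n) = term_coef j.
Proof.
move=> jw; rewrite /denominator_term /monomial_zt /= jw eqxx PoszD addrK eqxx //.
Qed.

Lemma denominator_term_neq0 m k (x : term_index) :
  (forall r, (2 <= tagged x r)%N) -> denominator_term x m k <> 0 ->
  exists2 n, k = Posz n & exists2 j, exponents_of_weight m (n + 2 * m) j &
    existT _ m j = x.
Proof.
case: x => m' j /= j2; rewrite /denominator_term /monomial_zt /=.
case: eqP => //= ->; case: eqP => //= -> _.
exists (weight j - 2 * m')%N; first by rewrite subzn // weight_ge.
by exists j; rewrite // subnK // weight_ge.
Qed.

Lemma formal_sum_denominator_series :
  formal_sum
    [set x : term_index | (1 <= tag x)%N /\ forall r, (2 <= tagged x r)%N]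
    denominator_term (coef_zt (denominator_series - 1)).
Proof.
set A := [set x : term_index | _] => m k.
(* [E n] is the finite set of indices that can contribute to z^m t^n. *)
pose E n := existT _ m @` exponents_of_weight m (n + 2 * m) : set term_index.
have supp x : A x -> denominator_term x m k <> 0 ->
    exists n, [/\ k = Posz n, (0 < m)%N & E n x].
  move=> [x1 x2] /(denominator_term_neq0 x2) [n kn [j jA xE]].
  by exists n; split=> //; [move: x1; rewrite -xE | exists j].
split.
  case: k supp => n supp; last first.
    apply: (@sub_finite_set _ _ set0) => // x [xA /(supp x xA)] [? []] //.
  apply: (@sub_finite_set _ _ (E n)).
    by move=> x [xA /(supp x xA)] [_ [[<-] _]].
  by apply: finite_image; apply: finite_exponents_of_weight.
(* This settles negative [k] and m = 0, where the coefficients of [denominator_series - 1] vanish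
   too. *)
have none : ~ (exists n, k = Posz n /\ (0 < m)%N) ->
    \sum_(x \in A) denominator_term x m k = 0.
  move=> kn; rewrite fsbig1 // => x xA; apply/eqP/negP => /negP/eqP.
  by case/(supp x xA) => n [kE m0 _]; apply: kn; exists n.
case: k supp none => n supp none; last by rewrite none // => -[? []].
case: m @E supp none => [|m] E supp none.
  rewrite none; last by case=> ? [].
  by rewrite /coef_zt fpsB (denominator_series_is_denominator.1) subrr.
have one_coef : (1 : {fps {fps Qq}}) m.+1 n = 0 by rewrite /= if_same.
rewrite /coef_zt !fpsB one_coef subr0 denominator_seriesE.
(* Indices of [A] outside [E n] contribute zero, so the sum may be restricted to [E n]. *)
rewrite -(fsbig_widen (E n)); first last.
- move=> x [xA xE] /=; apply/eqP/negP => /negP/eqP /(supp x xA)[n' [[<-] _]].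
  exact: xE.
- by move=> _ [j [j2 _] <-].
rewrite fsbig_image; last by move=> j j' _ _ /eqP; rewrite eq_Tagged => /eqP.
by apply: eq_fsbigr => j; rewrite inE => -[_ /denominator_termE ->].
Qed.

Theorem theorem2 :
  (exists! B : {fps {fps Qq}}, is_denominator B) /\
  forall B : {fps {fps Qq}}, is_denominator B ->
    P * B = subst_zt t q B /\
    formal_sum
      [set x : term_index | (1 <= tag x)%N /\ forall r, (2 <= tagged x r)%N]
      denominator_term
      (coef_zt (B - 1)).
Proof.
have denB := denominator_series_is_denominator; split.
  by exists denominator_series; split=> // B; apply: denominator_uniq.
move=> B Bden; split; first exact: denominator_ratio.
by rewrite (denominator_uniq Bden denB); apply: formal_sum_denominator_series.
Qed.
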